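(* Let $\Lambda$ be a finite, strongly connected $k$-graph, let $\delta\in(0,1)$, and suppose that the function $w_\delta$ on $F\mathcal B_\Lambda$ is a weight satisfying $w_\delta(\lambda)=\operatorname{diam}[\lambda]$ for all $\lambda\in F\mathcal B_\Lambda$. Then the zeta function $\zeta_\delta(s)=\frac12\operatorname{Tr}(|D|^{-s})=\sum_{\lambda\in F\mathcal B_\Lambda}w_\delta(\lambda)^s$ has abscissa of convergence $\delta$. Moreover, $\lim_{s\searrow\delta}\zeta_\delta(s)=\infty$. In particular, the spectral triple $(C_{\rm Lip}(X_{\mathcal B_\Lambda}),\ell^2(F\mathcal B_\Lambda,\mathbb C^2),\pi_\tau,D,\Gamma)$ is finitely summable (for every choice function $\tau$).
   Context: $\mathbb N=\{0,1,2,\dots\}$. A $k$-graph ($k\ge 1$) is a countable small category $\Lambda$ with a functor $d:\Lambda\to\mathbb N^k$ ($\mathbb N^k$ viewed as a one-object category under addition) such that whenever $d(\lambda)=m+n$ there are unique $\mu,\nu\in\Lambda$ with $d(\mu)=m$, $d(\nu)=n$, $\lambda=\mu\nu$. Here $\lambda\in\Lambda$ means $\lambda$ is a morphism; $\Lambda^n=d^{-1}(n)$; $\Lambda^0$ is identified with the objects (vertices); $r,s:\Lambda\to\Lambda^0$ are range and source. $\Lambda$ is finite if every $\Lambda^n$ is finite, and strongly connected if for all $v,w\in\Lambda^0$ there is $\lambda\in\Lambda$ with $r(\lambda)=v$, $s(\lambda)=w$. With $e_i$ the standard basis of $\mathbb N^k$, the adjacency matrices are $A_i(v,w)=\#\{\lambda\in\Lambda^{e_i}: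 r(\lambda)=v,\ s(\lambda)=w\}$; $\rho_i$ is the spectral radius of $A_i$. For $\Lambda$ finite and strongly connected, $x^\Lambda\in(0,\infty)^{\Lambda^0}$ is the unique positive vector with $\sum_v x^\Lambda_v=1$ and $A_ix^\Lambda=\rho_ix^\Lambda$ for $1\le i\le k$. The stationary $k$-Bratteli diagram $\mathcal B_\Lambda$ has vertex set $\bigsqcup_{n\ge0}\mathcal V_n$, each $\mathcal V_n$ a copy of $\Lambda^0$, and edge set $\bigsqcup_{n\ge1}\mathcal E_n$, where for $n\equiv i \pmod k$, $1\le i\le k$, $\mathcal E_n$ contains exactly $A_i(p,q)$ edges with range $p\in\mathcal V_{n-1}$ and source $q\in\mathcal V_n$. $F\mathcal B_\Lambda$ is the set of finite paths $\eta=\eta_1\cdots\eta_m$ ($\eta_i\in\mathcal E_i$, $s(\eta_i)=r(\eta_{i+1})$), of length $|\eta|=m$; vertices in $\mathcal V_0$ are the paths of length $0$. $X_{\mathcal B_\Lambda}$ is the set of infinite paths $(x_n)_{n\ge1}$, $x_n\in\mathcal E_n$, $s(x_n)=r(x_{n+1})$, with the topology generated by the cylinder sets $[\lambda]$ = set of infinite paths with initial segment $\lambda\in F\mathcal B_\Lambda$. A weight is a function $w:F\mathcal B_\Lambda\to(0,\infty)$ with $\sum_{v\in\mathcal V_0}w(v)\le1$, $\lim_{n}\sup\{w(\lambda):|\lambda|=n\}=0$, and $w(\lambda)<w(\eta)$ whenever $\eta$ is a proper initial segment of $\lambda$. For $\delta\in(0,1)$ and $|\eta|=qk+t$ with $q\in\mathbb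 N$, $0\le t\le k-1$, $$w_\delta(\eta)=\big(\rho_1^{q+1}\cdots\rho_t^{q+1}\rho_{t+1}^q\cdots\rho_k^q\big)^{-1/\delta}x^\Lambda_{s(\eta)}.$$ For $x\ne y$ in $X_{\mathcal B_\Lambda}$, $x\wedge y$ is the longest common initial segment in $F\mathcal B_\Lambda$ ($\emptyset$ if $r(x)\neq r(y)$); $d_\delta(x,y)=w_\delta(x\wedge y)$ if $x\wedge y\ne\emptyset$, $d_\delta(x,y)=1$ if $x\wedge y=\emptyset$, and $d_\delta(x,x)=0$; $\operatorname{diam}[\lambda]=\sup\{d_\delta(x,y):x,y\in[\lambda]\}$. Under the hypotheses of the claim, $X_{\mathcal B_\Lambda}$ is a Cantor set and $d_\delta$ is an ultrametric inducing its topology. A choice function is a map $\tau=(\tau_+,\tau_-):F\mathcal B_\Lambda\to X_{\mathcal B_\Lambda}\times X_{\mathcal B_\Lambda}$ with $\tau(\gamma)\in[\gamma]\times[\gamma]$ and $d_\delta(\tau_+(\gamma),\tau_-(\gamma))=\operatorname{diam}[\gamma]$. $C_{\rm Lip}(X_{\mathcal B_\Lambda})$ is the algebra of Lipschitz functions for $d_\delta$; on $\mathcal H=\ell^2(F\mathcal B_\Lambda,\mathbb C^2)$ put $\pi_\tau(f)=\bigoplus_\gamma\mathrm{diag}(f(\tau_+(\gamma)),f(\tau_-(\gamma)))$, $D=\bigoplus_\gamma\frac1{\operatorname{diam}[\gamma]}\begin{pmatrix}0&1\\1&0\end{pmatrix}$, $\Gamma=1\otimes\mathrm{diag}(1,-1)$.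 This is an even spectral triple, the Pearson–Bellissard spectral triple. The abscissa of convergence of $\zeta_\delta$ is the infimum of the $s>0$ for which $\zeta_\delta(s)$ converges (and the series diverges below it). The spectral triple is $p$-summable if $\zeta_\delta(p)<\infty$, and finitely summable if it is $p$-summable for some $p>0$. *)

(* Defs.v *)
(* The reals are an arbitrary R : realType, the complex numbers are R[i]. *)
From mathcomp Require Import all_boot all_order all_algebra.
From mathcomp Require Import spectral.
From mathcomp Require Import complex finmap.
From mathcomp Require Import all_classical all_reals all_analysis.

Set Implicit Arguments.
Unset Strict Implicit.
Unset Printing Implicit Defensive.

Import Order.TTheory GRing.Theory Num.Theory.
Import numFieldNormedType.Exports.

Local Open Scope classical_set_scope.
Local Open Scope ring_scope.

(** * k-graphs *)

(* The category is presented by its objects and its morphisms; [kcomp] is a total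
   function, but only its values on pairs with [ksrc l = krng m] are meaningful
   (and constrained).  [kcomp l m] is the composite written lm. *)
Record kgraph (k : nat) := KGraph {
  kvert : countType;
  kmor : countType;
  krng : kmor -> kvert;
  ksrc : kmor -> kvert;
  kid : kvert -> kmor;
  kcomp : kmor -> kmor -> kmor;
  kdeg : kmor -> 'rV[nat]_k;
  kgraph_rank_gt0 : (0 < k)%N;
  krng_id : forall v, krng (kid v) = v;
  ksrc_id : forall v, ksrc (kid v) = v;
  krng_comp : forall l m, ksrc l = krng m -> krng (kcomp l m) = krng l;
  ksrc_comp : forall l m, ksrc l = krng m -> ksrc (kcomp l m) = ksrc m;
  kcomp_idl : forall l, kcomp (kid (krng l)) l = l;
  kcomp_idr : forall l, kcomp l (kid (ksrc l)) = l;
  kcompA : forall l m n, ksrc l = krng m -> ksrc m = krng n ->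
    kcomp l (kcomp m n) = kcomp (kcomp l m) n;
  kdeg_id : forall v, kdeg (kid v) = 0;
  kdeg_comp : forall l m, ksrc l = krng m ->
    kdeg (kcomp l m) = kdeg l + kdeg m;
  kfactorization : forall l (m n : 'rV[nat]_k), kdeg l = m + n ->
    exists! p : kmor * kmor,
      [/\ kdeg p.1 = m, kdeg p.2 = n, ksrc p.1 = krng p.2
        & l = kcomp p.1 p.2]
}.

Section KGraphs.
Context {k : nat}.
Implicit Type L : kgraph k.

Definition kgraph_finite L :=
  forall n : 'rV[nat]_k, finite_set [set l : kmor L | kdeg l = n].

Definition strongly_connected L :=
  forall v w : kvert L, exists l : kmor L, krng l = v /\ ksrc l = w.

(* The entry A_i(v,w).  [fset_set] is the underlying finite set of a finite set,
   so this is the number of such morphisms as soon as [L] is finite. *)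
Definition adj L (i : 'I_k) (v w : kvert L) : nat :=
  #|` fset_set [set l : kmor L |
       [/\ kdeg l = delta_mx 0 i, krng l = v & ksrc l = w]] |.

(* A duplicate-free list of all vertices when [L] is finite. *)
Definition verts L : seq (kvert L) := fset_set [set: kvert L].

Definition adj_mx (C : nzRingType) L (i : 'I_k) : 'M[C]_(size (verts L)) :=
  \matrix_(a, b) (adj i (tnth (in_tuple (verts L)) a)
                        (tnth (in_tuple (verts L)) b))%:R.

End KGraphs.

Definition spectral_radius (R : realType) n (A : 'M[R[i]]_n) : R :=
  sup [set Normc.normc a | a in [set a : R[i] | eigenvalue A a]].

Section PerronFrobenius.
Context (R : realType) {k : nat} (L : kgraph k).

Definition rho (i : 'I_k) : R := spectral_radius (adj_mx R[i] L i).

Definition perron_frobenius_vector (x : kvert L -> R) :=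
  [/\ forall v, 0 < x v,
      \sum_(v <- verts L) x v = 1
    & forall i v, \sum_(w <- verts L) (adj i v w)%:R * x w = rho i * x v].

(* The Perron-Frobenius eigenvector x^L of [L]; the default value 0 of [xget] is
   only taken when there is no such vector. *)
Definition xLambda : kvert L -> R :=
  xget (fun=> 0) [set x | perron_frobenius_vector x].

End PerronFrobenius.

Arguments rho R {k} L i.
Arguments xLambda R {k} L v.

(** * The stationary k-Bratteli diagram *)

Section Bratteli.
Context {k : nat} (L : kgraph k).

(* Edges are coded as triples (p, q, j): the j-th edge with range p and source q.
   Levels are counted from 0, so [is_edge n] carves out E_(n+1), and the colours
   are counted from 0 as well: E_(n+1) is built from the matrix A_((n mod k)+1). *)
Definition bedge : Type := (kvert L * kvert L * nat)%type.

Definition erng (e : bedge) : kvert L := e.1.1.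
Definition esrc (e : bedge) : kvert L := e.1.2.

Definition color (n : nat) : 'I_k := Ordinal (ltn_pmod n (kgraph_rank_gt0 L)).

Definition is_edge (n : nat) (e : bedge) : bool :=
  (e.2 < adj (color n) (erng e) (esrc e))%N.

(* [chain n v s]: the list s is a path which starts at the vertex v of V_n and
   whose edges lie successively in E_(n+1), E_(n+2), ... *)
Fixpoint chain (n : nat) (v : kvert L) (s : seq bedge) : bool :=
  if s is e :: s' then [&& erng e == v, is_edge n e & chain n.+1 (esrc e) s']
  else true.

(* FB: a finite path is given by its range in V_0 and the list of its edges, so
   that the paths of length 0 are the vertices of V_0. *)
Definition bpath : Type :=
  {g : kvert L * seq bedge | chain 0 g.1 g.2}.

Definition frng (g : bpath) : kvert L := (val g).1.
Definition fedges (g : bpath) : seq bedge := (val g).2.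
Definition flen (g : bpath) : nat := size (fedges g).
Definition fsrc (g : bpath) : kvert L := last (frng g) (map esrc (fedges g)).

Definition fvertex (v : kvert L) : bpath :=
  exist (fun g : kvert L * seq bedge => chain 0 g.1 g.2) (v, [::]) isT.

Definition proper_initial_segment (g h : bpath) : Prop :=
  [/\ frng g = frng h, prefix (fedges g) (fedges h) & (flen g < flen h)%N].

(* [x n] is the edge x_(n+1) in E_(n+1). *)
Record ipath := IPath {
  ipath_edge :> nat -> bedge;
  ipath_is_edge : forall n, is_edge n (ipath_edge n);
  ipath_chain : forall n, esrc (ipath_edge n) = erng (ipath_edge n.+1)
}.

Definition irng (x : ipath) : kvert L := erng (x 0%N).

Lemma initial_chain (x : ipath) (n : nat) : chain 0 (irng x) (mkseq x n).
Proof.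
suff H m v : erng (x m) = v -> chain m v [seq x i | i <- iota m n] by exact: H.
elim: n m v => [//|n IHn] m v /= ->.
by rewrite eqxx ipath_is_edge /=; apply: IHn; rewrite ipath_chain.
Qed.

Definition initial (x : ipath) (n : nat) : bpath :=
  exist (fun g : kvert L * seq bedge => chain 0 g.1 g.2)
        (irng x, mkseq x n) (initial_chain x n).

Definition cylinder (g : bpath) : set ipath := [set x | initial x (flen g) = g].

(* x /\ y for x and y distinct, [ex_minn] giving the least n at which the
   edges x_(n+1) and y_(n+1) differ; [None] is the empty path. *)
Definition meet_path (x y : ipath) (xy : exists n, x n != y n) : option bpath :=
  if irng x == irng y then Some (initial x (ex_minn xy)) else None.

End Bratteli.

(** * Weights, the metric d_w and its diameters *)

Section Weights.
Context (R : realType) {k : nat} (L : kgraph k).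
Implicit Type w : bpath L -> R.

Definition is_weight w :=
  [/\ forall g, 0 < w g,
      (\esum_(v in [set: kvert L]) (w (fvertex v))%:E <= 1)%E,
      sup [set w g | g in [set g | flen g = n]] @[n --> \oo] --> (0 : R)
    & forall g h, proper_initial_segment g h -> w h < w g].

(* With |g| = q k + t, the colours i < t get the exponent q + 1 and the others
   get the exponent q. *)
Definition w_delta (delta : R) (g : bpath L) : R :=
  (\prod_(i < k) rho R L i ^+ (flen g %/ k + (i < flen g %% k))%N)
    `^ (- (1 / delta)) * xLambda R L (fsrc g).

(* d_w x y is 0 if x = y (all the edges agree), w (x /\ y) if x /\ y is not empty,
   and 1 otherwise. *)
Definition dist_of w (x y : ipath L) : R :=
  match pselect (exists n, x n != y n) with
  | left xy => if meet_path xy is Some g then w g else 1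
  | right _ => 0
  end.

Definition d_delta (delta : R) : ipath L -> ipath L -> R :=
  dist_of (w_delta delta).

Definition diam (delta : R) (g : bpath L) : R :=
  sup [set d_delta delta z.1 z.2 | z in cylinder g `*` cylinder g].

Definition choice_function (delta : R) (tau : bpath L -> ipath L * ipath L) :=
  forall g, [/\ cylinder g (tau g).1, cylinder g (tau g).2
    & d_delta delta (tau g).1 (tau g).2 = diam delta g].

End Weights.

Arguments w_delta {R k} L delta g.
Arguments d_delta {R k} L delta x y.
Arguments diam {R k L} delta g.

(** * Direct sums of 2x2 blocks on l^2(I, C^2) *)

Section BlockOperators.
Context (R : realType) (I : Type).

(* T : blockop stands for the operator (+)_g T_g on l^2(I, C^2), with domain the
   vectors xi of l^2(I, C^2) such that (T_g xi_g)_g is again in l^2(I, C^2). *)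
Definition blockop := I -> 'M[R[i]]_2.

(* The data of an even spectral triple whose Hilbert space consists of C^2-valued
   families and all of whose operators are direct sums of 2x2 blocks. *)
Record block_triple (X : Type) := BlockTriple {
  bt_algebra : set (X -> R[i]);
  bt_space : set (I -> 'cV[R[i]]_2);
  bt_rep : (X -> R[i]) -> blockop;
  bt_dirac : blockop;
  bt_grading : blockop
}.

End BlockOperators.

Section Blocks.
Context (R : realType) (I : choiceType).

(* The Hilbert space l^2(I, C^2). *)
Definition ell2 : set (I -> 'cV[R[i]]_2) :=
  [set xi | (\esum_(g in [set: I])
     (\sum_(j < 2) Normc.normc (xi g j 0) ^+ 2)%:E < +oo)%E].

(* |M|^p for a normal matrix M: the function a |-> |a|^p is applied to M through
   the spectral decomposition of M (functional calculus). *)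
Definition absmx_pow n (M : 'M[R[i]]_n) (p : R) : 'M[R[i]]_n :=
  invmx (spectralmx M)
    *m diag_mx (map_mx (fun a => (Normc.normc a `^ p)%:C%C)
                       (spectral_diag M))
    *m spectralmx M.

Definition abs_pow (T : blockop R I) (p : R) : blockop R I :=
  fun g => absmx_pow (T g) p.

(* The trace, in [0, +oo], of a positive operator: the sum of the <T e, e> over
   the canonical orthonormal basis of l^2(I, C^2). *)
Definition Tr (T : blockop R I) : \bar R :=
  \esum_(g in [set: I]) (complex.Re (\tr (T g)))%:E.

Definition zeta_of (D : blockop R I) (s : R) : \bar R :=
  ((2^-1)%:E * Tr (abs_pow D (- s)))%E.

Definition summable (X : Type) (S : block_triple R I X) (p : R) :=
  (zeta_of (bt_dirac S) p < +oo)%E.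

Definition finitely_summable (X : Type) (S : block_triple R I X) :=
  exists2 p : R, 0 < p & summable S p.

End Blocks.

(** * The Pearson-Bellissard spectral triple *)

Section PearsonBellissard.
Context (R : realType) {k : nat} (L : kgraph k) (delta : R).

Definition C_Lip : set (ipath L -> R[i]) :=
  [set f | exists K : R, forall x y,
     Normc.normc (f x - f y) <= K * d_delta L delta x y].

Definition diag2 (a b : R[i]) : 'M[R[i]]_2 :=
  diag_mx (\row_j (if j == 0 then a else b)).

Definition PB_rep (tau : bpath L -> ipath L * ipath L) (f : ipath L -> R[i]) :
  blockop R (bpath L) := fun g => diag2 (f (tau g).1) (f (tau g).2).

Definition PB_dirac : blockop R (bpath L) :=
  fun g => ((diam delta g)^-1)%:C%C *: \matrix_(i, j) (i != j)%:R.

Definition PB_grading : blockop R (bpath L) := fun=> diag2 1 (-1).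

Definition PB_triple (tau : bpath L -> ipath L * ipath L) :
    block_triple R (bpath L) (ipath L) :=
  BlockTriple C_Lip (@ell2 R (bpath L)) (PB_rep tau) PB_dirac PB_grading.

Definition zeta (s : R) : \bar R := zeta_of PB_dirac s.

End PearsonBellissard.

(* The infimum is taken in the extended reals, where that of the empty set
   is +oo. *)
Definition abscissa_of_convergence (R : realType) (z : R -> \bar R) (a : R) :=
  ereal_inf [set s%:E | s in [set s : R | 0 < s /\ (z s < +oo)%E]] = a%:E
  /\ forall s, 0 < s -> s < a -> z s = +oo%E.

(* Main.v *)
(* The positivity of the weight forces the Perron-Frobenius vector x to exist and,
   with the diameter hypothesis, an infinite path; hence all rho_i > 0.  Let c_n be
   the product of the spectral radii of the first n colours.  Since A_i x = rho_i x,
   the sum of x_{s(g)} over the paths g of length n is c_n, and as x is bounded away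
   from 0 and infinity the sum of w_delta(g)^s over these paths is comparable to
   c_n^(1 - s/delta).  With P = rho_1 ... rho_k one has c_{n+k} = P c_n, and P > 1
   because the weights tend to 0 along infinite paths.  So the series behaves like a
   geometric series of ratio P^(1 - s/delta). *)
Require Import Defs.
From mathcomp Require Import all_boot all_order all_algebra.
From mathcomp Require Import spectral complex finmap zify lra.
From mathcomp Require Import all_classical all_reals all_analysis.

Import Order.TTheory GRing.Theory Num.Theory.
Import numFieldNormedType.Exports.
Local Open Scope classical_set_scope.
Local Open Scope ring_scope.

(** * Series graded by finite levels, and quasi-geometric sums *)

Section GradedSums.
Context {R : realType} {T : choiceType} {len : T -> nat} {level : nat -> seq T}.
Hypothesis level_uniq : forall n, uniq (level n).
Hypothesis mem_level : forall n t, (t \in level n) = (len t == n).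

(** The finite levels partition [T] and the terms are nonnegative, so the unordered sum may be
    regrouped level by level. *)
Lemma esum_graded (f : T -> R) : (forall t, 0 <= f t) ->
  (\esum_(t in [set: T]) (f t)%:E =
   \sum_(0 <= n <oo) (\sum_(t <- level n) f t)%:E)%E.
Proof.
move=> f0; have -> : [set: T] = \bigcup_n [set` level n].
  by rewrite eqEsubset; split=> // t _; exists (len t) => //=; rewrite mem_level.
have f0E t : (0 <= (f t)%:E)%E by rewrite lee_fin.
have level_triv : trivIset [set: nat] (fun n => [set` level n]).
  by move=> i j _ _ [t []] /=; rewrite !mem_level => /eqP <- /eqP.
rewrite nneseries_sum_bigcup//; apply: eq_eseriesr => n _.
by rewrite esum_fset// -fsbig_seq// sumEFin.
Qed.

Lemma esum_graded_ub (f : T -> R) (K : R) : (forall t, 0 <= f t) ->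
  (forall N, \sum_(n < N) \sum_(t <- level n) f t <= K) ->
  (\esum_(t in [set: T]) (f t)%:E <= K%:E)%E.
Proof.
move=> f0 fK; rewrite esum_graded//; apply: lime_le.
  by apply: is_cvg_nneseries => n _ _; rewrite ?lee_fin ?sumr_ge0.
by apply: nearW => N; rewrite sumEFin lee_fin big_mkord.
Qed.

Lemma esum_graded_lb (f : T -> R) N : (forall t, 0 <= f t) ->
  ((\sum_(n < N) \sum_(t <- level n) f t)%:E
   <= \esum_(t in [set: T]) (f t)%:E)%E.
Proof.
move=> f0; rewrite esum_graded// -sumEFin.
rewrite -(big_mkord xpredT (fun n => (\sum_(t <- level n) f t)%:E)).
by apply: nneseries_lim_ge => n _ _; rewrite lee_fin sumr_ge0.
Qed.

End GradedSums.

(** With S_N the partial sums, shifting the index by [k] gives S_{k+N} <= S_k + r S_N. Since S_N <=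
    S_{k+N}, the inequality can be solved for S_N. *)
Lemma sum_quasi_geometric_le {R : realFieldType} (a : nat -> R) (k : nat)
    (r : R) (N : nat) : 0 <= r < 1 -> (forall n, 0 <= a n) ->
  (forall n, a (k + n)%N <= r * a n) ->
  \sum_(n < N) a n <= (\sum_(n < k) a n) / (1 - r).
Proof.
move=> /andP[r0 r1] a0 ar; have r1' : 0 < 1 - r by rewrite subr_gt0.
set S := \sum_(n < k + N) a n.
have SE : S = \sum_(n < k) a n + \sum_(n < N) a (k + n)%N.
  by rewrite /S big_split_ord.
have leS : \sum_(n < N) a n <= S.
  by rewrite /S addnC big_split_ord /= lerDl sumr_ge0.
rewrite (le_trans leS)// ler_pdivlMr// mulrBr mulr1 lerBlDr mulrC {1}SE lerD2l.
apply: (@le_trans _ _ (r * \sum_(n < N) a n)); last by rewrite ler_wpM2l.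
by rewrite mulr_sumr ler_sum.
Qed.

(** * Functional calculus of a normal matrix with scalar square *)

(** Diagonalising M^2 = a^2 shows that each eigenvalue d_j has |d_j|^2 = a^2, hence modulus [a]
    whatever its argument; so |M|^p has the same diagonal entry a^p throughout. *)
Lemma trace_absmx_pow {R : realType} n (M : 'M[R[i]]_n) (a p : R) :
  0 <= a -> M \is normalmx -> M *m M = (a ^+ 2)%:C%C%:M ->
  \tr (absmx_pow M p) = (a `^ p *+ n)%:C%C.
Proof.
move=> a0 Mn MM; rewrite /absmx_pow mxtrace_mulC mulmxA.
have Uu := spectral_unit M; rewrite mulmxV// mul1mx mxtrace_diag.
have /orthomx_spectralP := Mn; set P := spectralmx M; set d := spectral_diag M.
move=> ME.
have dd : diag_mx d *m diag_mx d = (a ^+ 2)%:C%C%:M.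
  have -> : diag_mx d = P *m M *m invmx P.
    by rewrite ME !mulmxA mulmxV// mul1mx -mulmxA mulmxV// mulmx1.
  rewrite !mulmxA -(mulmxA (P *m M)) mulVmx// mulmx1 -(mulmxA P) MM.
  by rewrite mul_mx_scalar -scalemxAl mulmxV// scalemx1.
rewrite (eq_bigr (fun=> (a `^ p)%:C%C)) => [|j _].
  by rewrite sumr_const card_ord rmorphMn.
rewrite mxE; congr (_ `^ _)%:C%C.
have /matrixP/(_ j j) := dd; rewrite mulmx_diag !mxE eqxx !mulr1n.
move=> /(congr1 (@Normc.normc R)); rewrite Normc.normcM.
have -> : Normc.normc (a ^+ 2)%:C%C = a ^+ 2.
  by rewrite /= expr0n addr0 sqrtr_sqr ger0_norm ?sqr_ge0.
have n0 : 0 <= Normc.normc (d 0 j) by case: (d 0 j) => u v /=; exact: sqrtr_ge0.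
by move/eqP; rewrite -expr2 eqrXn2// => /eqP.
Qed.

(** * Enumeration of the finite paths and their eigenvector sums *)

Section Paths.
Context {k : nat} (L : kgraph k).
Hypothesis L_finite : kgraph_finite L.

Lemma finite_verts : finite_set [set: kvert L].
Proof.
have := L_finite 0; set Z := [set l | _] => Zfin.
have -> : [set: kvert L] = @kid _ L @^-1` Z.
  by rewrite eqEsubset; split=> // v _; exact: kdeg_id.
apply: finite_preimage => // u v _ _ uv.
by rewrite -(krng_id u) -(krng_id v) uv.
Qed.

Lemma mem_verts v : v \in verts L.
Proof. by rewrite /verts in_fset_set ?inE//; exact: finite_verts. Qed.

Lemma verts_uniq : uniq (verts L).
Proof. exact: fset_uniq. Qed.

Definition edges_from (n : nat) (v : kvert L) : seq (bedge L) :=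
  [seq (v, q, j) | q <- verts L, j <- iota 0 (adj (color L n) v q)].

Fixpoint chains (n : nat) (v : kvert L) (m : nat) : seq (seq (bedge L)) :=
  if m is m'.+1 then
    [seq e :: s | e <- edges_from n v, s <- chains n.+1 (esrc e) m']
  else [:: [::]].

(** [insub] only reattaches the proof of [chain]; it discards nothing, as [chains 0 v m] consists of
    chains. *)
Definition paths (m : nat) : seq (bpath L) :=
  pmap insub [seq (v, s) | v <- verts L, s <- chains 0 v m].

Lemma mem_edges_from n v e :
  (e \in edges_from n v) = (erng e == v) && is_edge n e.
Proof.
apply/allpairsPdep/andP => [[q [j [_ + ->]]]|[/eqP ev en]].
  by rewrite mem_iota add0n /= => jlt; rewrite /erng eqxx.
case: e ev en => [[p q] j] /= <- en; exists q, j; split => //.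
  exact: mem_verts.
by rewrite mem_iota.
Qed.

Lemma edges_from_uniq n v : uniq (edges_from n v).
Proof.
apply: allpairs_uniq_dep => [|q _|]; first exact: verts_uniq.
  exact: iota_uniq.
by move=> [q j] [q' j'] _ _ /= [-> ->].
Qed.

Lemma mem_chains n v m s :
  (s \in chains n v m) = (size s == m) && chain n v s.
Proof.
elim: m n v s => [|m IHm] n v s /=; first by rewrite inE; case: s.
apply/allpairsPdep/andP => [[e [s' []]]|].
  rewrite mem_edges_from IHm => /andP[/eqP ev en] /andP[/eqP sm cs] ->.
  by rewrite /= sm eqxx ev eqxx en.
case: s => [[]//|e s]; rewrite /= eqSS => -[sm /and3P[ev en cs]].
by exists e, s; rewrite mem_edges_from ev en IHm sm cs.
Qed.

Lemma chains_uniq n v m : uniq (chains n v m).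
Proof.
elim: m n v => [//|m IHm] n v /=.
apply: allpairs_uniq_dep => [|e _|]; [exact: edges_from_uniq|exact: IHm|].
by move=> [e s] [e' s'] _ _ /= [-> ->].
Qed.

Lemma mem_paths m (g : bpath L) : (g \in paths m) = (flen g == m).
Proof.
rewrite mem_pmap_sub; case: g => [[v s] /= cs]; rewrite /flen /fedges /=.
apply/allpairsPdep/idP => [[v' [s' [_]]]|sm].
  by rewrite mem_chains => /andP[/eqP <- _] [_ ->].
by exists v, s; rewrite mem_verts mem_chains sm cs.
Qed.

Lemma paths_uniq m : uniq (paths m).
Proof.
apply: pmap_sub_uniq; apply: allpairs_uniq_dep => [|v _|].
- exact: verts_uniq.
- exact: chains_uniq.
- by move=> [v s] [v' s'] _ _ /= [-> ->].
Qed.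

Context {R : realType} (x : kvert L -> R).
Hypothesis x_eigen : forall i v,
  \sum_(w <- verts L) (adj i v w)%:R * x w = rho R L i * x v.

Lemma sum_edges_from n v :
  \sum_(e <- edges_from n v) x (esrc e) = rho R L (color L n) * x v.
Proof.
rewrite -x_eigen big_allpairs_dep; apply: eq_bigr => q _.
rewrite (eq_bigr (fun=> x q))// big_const_seq count_predT size_iota iter_addr_0.
by rewrite mulr_natl.
Qed.

(** Induction on the first edge: the rest of the path starts one level further, and the eigenvector
    equation for the colour of level [n] evaluates the remaining sum over that edge. *)
Lemma sum_chains n v m :
  \sum_(s <- chains n v m) x (last v (map (@esrc _ L) s)) =
  (\prod_(i < m) rho R L (color L (n + i))) * x v.
Proof.
elim: m n v => [|m IHm] n v /=; first by rewrite big_seq1 big_ord0 mul1r.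
pose c n := \prod_(i < m) rho R L (color L (n + i)).
rewrite big_allpairs_dep (eq_bigr (fun e => c n.+1 * x (esrc e))) => [|e _].
  have cS : c n.+1 = \prod_(i < m) rho R L (color L (n + lift ord0 i)).
    by apply: eq_bigr => i _; rewrite addSnnS.
  by rewrite -mulr_sumr sum_edges_from big_ord_recl addn0 cS mulrCA mulrA.
by rewrite -IHm.
Qed.

Lemma sum_paths m :
  \sum_(g <- paths m) x (fsrc g) =
  (\prod_(i < m) rho R L (color L i)) * \sum_(v <- verts L) x v.
Proof.
rewrite big_pmap big_allpairs_dep mulr_sumr; apply: eq_bigr => v _.
rewrite -(sum_chains 0) big_seq [RHS]big_seq; apply: eq_bigr => s.
by rewrite mem_chains => /andP[_ cs]; rewrite insubT.
Qed.

End Paths.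

(** * Colour counts and the zeta function as a series *)

(** This is how often colour [j] occurs among the first [m] levels, that is, the exponent of rho_j
    in [w_delta]. *)
Lemma countn_mod (k m j : nat) : (j < k)%N ->
  (\sum_(i < m) (i %% k == j) = m %/ k + (j < m %% k))%N.
Proof.
move=> jk; have k0 : (0 < k)%N by exact: leq_ltn_trans jk.
elim: m => [|m IHm]; first by rewrite big_ord0 div0n mod0n.
rewrite big_ord_recr /= IHm divnS// modnS -addnA.
have := ltn_pmod m k0.
case: ifPn => [km|_].
  (* When [k] divides m + 1 a period closes: the residue k - 1 drops to 0 and the quotient grows by
     one. *)
  have -> : (m %% k = k.-1)%N.
    move: km; rewrite /dvdn -addn1 -modnDml addn1 => km.
    have := ltn_pmod m k0; rewrite leq_eqVlt => /orP[/eqP mk|lt].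
      by rewrite -[in RHS]mk.
    by move: km; rewrite (modn_small lt).
  lia.
lia.
Qed.

Lemma prod_color {R : realType} {k : nat} (L : kgraph k) (m : nat) :
  \prod_(i < m) rho R L (color L i) =
  \prod_(i < k) rho R L i ^+ (m %/ k + (i < m %% k))%N.
Proof.
rewrite (partition_big (fun i : 'I_m => color L i) xpredT)//=.
apply: eq_bigr => j _; rewrite -countn_mod//.
rewrite (eq_bigr (fun=> rho R L j)) => [|i /eqP <- //].
by rewrite prodr_const -sum1_card big_mkcond; congr (_ ^+ _).
Qed.

(** Each block of D squares to the scalar diam^(-2), so its trace in |D|^(-s) is 2 diam^s; the
    factor 1/2 of [zeta_of] cancels the 2. *)
Lemma zeta_series {R : realType} {k : nat} (L : kgraph k) (delta s : R) :
  (forall g : bpath L, 0 < diam delta g) ->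
  zeta L delta s = (\esum_(g in [set: bpath L]) (diam delta g `^ s)%:E)%E.
Proof.
move=> diam_gt0; rewrite /zeta /zeta_of /Tr.
rewrite (eq_esum (b := fun g : bpath L =>
    ((diam delta g `^ s)%:E + (diam delta g `^ s)%:E)%E)) => [|g _].
  have ge0 (g : bpath L) : (0 <= (diam delta g `^ s)%:E)%E.
    by rewrite lee_fin powR_ge0.
  rewrite esumD//; move: (esum_ge0 (S := [set: bpath L]) (fun g _ => ge0 g)).
  (* The sum may be infinite, and then so is half of its double; nonnegativity rules out the value
     -oo. *)
  case: (esum _ _) => [z _|_|//]; last first.
    by rewrite addye// gt0_muley// lte_fin; lra.
  by rewrite -EFinD -EFinM; congr EFin; lra.
have a0 := diam_gt0 g.
rewrite /abs_pow (@trace_absmx_pow _ _ _ (diam delta g)^-1).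
- rewrite /= powRN -(powR_inv1 (ltW a0)) -powRrM mulN1r powRN invrK.
  by rewrite mulr2n EFinD.
- by rewrite invr_ge0 ltW.
- apply: symmetric_normalmx.
    apply/is_hermitianmxP; rewrite expr0 scale1r; apply/matrixP => i j.
    by rewrite !mxE eq_sym.
  apply/mxOverP => i j; rewrite !mxE rpredM ?realn//.
  by rewrite complex_real.
- rewrite /PB_dirac -scalemxAl -scalemxAr scalerA -rmorphM -expr2 -scalemx1.
  congr (_ *: _); apply/matrixP => i j; rewrite !mxE big_ord_recl big_ord1 !mxE.
  by case: i j => [[|[|[]]]//= ?] [[|[|[]]]//= ?];
    rewrite ?mulr0 ?mul0r ?mulr1 ?addr0 ?add0r.
Qed.

Lemma sum_multiples_le {R : numDomainType} (f : nat -> R) (k N : nat) :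
  (0 < k)%N -> (forall n, 0 <= f n) ->
  \sum_(q < N) f (k * q)%N <= \sum_(n < k * N) f n.
Proof.
case: k => // k _ f0; elim: N => [|N IHN]; first by rewrite muln0 !big_ord0.
rewrite mulnS addnC big_split_ord big_ord_recr /=; apply: lerD => //.
by rewrite big_ord_recl /= addn0 lerDl sumr_ge0.
Qed.

Lemma seq_pos_lb {R : realFieldType} {T : eqType} (s : seq T) (f : T -> R) :
  (forall t, 0 < f t) -> exists2 m, 0 < m & {in s, forall t, m <= f t}.
Proof.
move=> f0; elim: s => [|t s [m m0 ms]]; first by exists 1.
exists (Num.min m (f t)); first by rewrite lt_min m0 f0.
move=> u; rewrite inE => /predU1P[->|us]; first by rewrite ge_min lexx orbT.
by rewrite ge_min ms.
Qed.

Lemma one_powR {R : realType} (t : R) : 1 `^ t = 1.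
Proof. by rewrite powR1. Qed.

Lemma gt1_powR_lt1 {R : realType} (a e : R) : 1 < a -> e < 0 -> a `^ e < 1.
Proof.
move=> a1 e0; have -> : e = - (- e) by rewrite opprK.
rewrite powRN invf_lt1 ?powR_gt0 ?(lt_trans _ a1)//.
rewrite -[ltLHS](one_powR (- e)) gt0_ltr_powR ?oppr_gt0 ?nnegrE ?ler01//.
exact: ltW (lt_trans ltr01 a1).
Qed.

Lemma prod_color_period {R : comNzRingType} {k : nat} (L : kgraph k)
    (f : 'I_k -> R) (m : nat) :
  \prod_(i < k + m) f (color L i) =
  (\prod_(i < k) f i) * \prod_(i < m) f (color L i).
Proof.
rewrite big_split_ord /=; congr (_ * _); apply: eq_bigr => i _; congr f.
  by apply: val_inj; rewrite /= modn_small.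
by apply: val_inj; rewrite /= modnDl.
Qed.

(** * Comparison of the weight series with a geometric series *)

Section LevelSums.
Context {R : realType} {k : nat} {L : kgraph k} {delta : R}.
Hypothesis L_nonempty : [set: kvert L] !=set0.
Hypothesis L_finite : kgraph_finite L.
Hypothesis delta_gt0 : 0 < delta.
Hypothesis w_weight : is_weight (w_delta L delta).
Hypothesis w_diam : forall g : bpath L, w_delta L delta g = diam delta g.

Local Notation w := (w_delta L delta).
Local Notation x := (xLambda R L).
Local Notation P := (\prod_(i < k) rho R L i).

Let c (m : nat) : R := \prod_(i < m) rho R L (color L i).

Let k_gt0 : (0 < k)%N := kgraph_rank_gt0 L.

Let w_gt0 g : 0 < w g.
Proof. by case: w_weight. Qed.

(* Positivity of the weight forces the Perron-Frobenius vector to exist: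
   otherwise [xLambda] would be the default value 0. *)
Lemma xLambda_spec : perron_frobenius_vector (xLambda R L).
Proof.
apply: xgetPex; apply: contrapT => noPF; have [v _] := L_nonempty.
have := w_gt0 (fvertex v); rewrite /w_delta /xLambda xgetPN ?mulr0 ?ltxx//.
by move=> y PFy; apply: noPF; exists y.
Qed.

Let x_gt0 v : 0 < x v.
Proof. by case: xLambda_spec. Qed.

Lemma xLambda_le1 v : x v <= 1.
Proof.
have [_ <- _] := xLambda_spec.
rewrite (bigD1_seq v) ?mem_verts ?verts_uniq//= lerDl.
by apply: sumr_ge0 => u _; exact: ltW.
Qed.

(** Without infinite paths every cylinder is empty, and its diameter is the default value 0 of
    [sup], against the positivity of the weight. *)
Lemma exists_ipath : exists _ : ipath L, True.
Proof.
apply: contrapT => noX; have [v _] := L_nonempty.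
have := w_gt0 (fvertex v); rewrite w_diam /diam (_ : [set _ | _ in _] = set0).
  by rewrite sup0 ltxx.
by rewrite -subset0 => y [[p q]] _ _; apply: noX; exists p.
Qed.

(** An infinite path contains an edge of colour [i], so A_i has a positive entry, and the
    corresponding row of A_i x = rho_i x is positive. *)
Lemma rho_gt0 i : 0 < rho R L i.
Proof.
have [p _] := exists_ipath; have [_ _ x_eigen] := xLambda_spec.
have := ipath_is_edge p i; rewrite /is_edge.
have -> : color L i = i by apply: val_inj; rewrite /= modn_small.
set u := erng _; set v := esrc _; move=> /(leq_ltn_trans (leq0n _)) adj_gt0.
rewrite -(pmulr_lgt0 _ (x_gt0 u)) -x_eigen.
rewrite (bigD1_seq v) ?mem_verts ?verts_uniq//= ltr_pwDl//.
  by rewrite mulr_gt0 ?ltr0n.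
by apply: sumr_ge0 => z _; rewrite mulr_ge0 ?ler0n// ltW.
Qed.

Let c_gt0 m : 0 < c m.
Proof. by apply: prodr_gt0 => i _; exact: rho_gt0. Qed.

Let P_gt0 : 0 < P.
Proof. by apply: prodr_gt0 => i _; exact: rho_gt0. Qed.

Let cD m : c (k + m) = P * c m.
Proof.
exact: (prod_color_period L (rho R L)).
Qed.

Let cM q : c (k * q) = P ^+ q.
Proof.
elim: q => [|q IHq]; first by rewrite muln0 /c big_ord0.
by rewrite mulnS cD IHq exprS.
Qed.

Let wE g : w g = c (flen g) `^ (- (1 / delta)) * x (fsrc g).
Proof. by rewrite /c prod_color. Qed.

(* Otherwise the weights of the initial segments of length kq of an infinite path
   would stay away from 0. *)
Lemma prod_rho_gt1 : 1 < P.
Proof.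
have [m m0 mx] := seq_pos_lb (verts L) _ x_gt0.
have [p _] := exists_ipath; have [_ _ w_cvg0 _] := w_weight.
rewrite ltNge; apply/negP => P_le1.
have [N _ supN] := cvgr_lt _ w_cvg0 _ m0.
have leN : (N <= k * N)%N by rewrite leq_pmull.
have := supN _ leN; apply/negP; rewrite -leNgt.
set g := initial p (k * N).
have lg : flen g = (k * N)%N by rewrite /flen /fedges /= size_mkseq.
apply: (@le_trans _ _ (w g)).
  (* If P <= 1 then (P^N)^(-1/delta) >= 1, so the weight is at least x >= m. *)
  rewrite wE lg cM (le_trans (mx _ (mem_verts L L_finite (fsrc g))))//.
  apply: ler_peMl; first exact: ltW.
  rewrite powRN invf_ge1 ?powR_gt0 ?exprn_gt0//.
  rewrite -[leRHS](one_powR (1 / delta)); apply: ge0_ler_powR.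
  - by rewrite divr_ge0// ltW.
  - by rewrite nnegrE exprn_ge0// ltW.
  - by rewrite nnegrE ler01.
  - by rewrite exprn_ile1// ltW.
apply: ub_le_sup; last by exists g.
(* An upper bound for the whole level, valid because x <= 1. *)
exists (c (k * N) `^ (- (1 / delta))) => _ [h /= lh <-].
by rewrite wE lh ler_piMr ?powR_ge0 ?xLambda_le1.
Qed.

Let sum_level n : \sum_(g <- paths L n) x (fsrc g) = c n.
Proof.
have [_ sumx x_eigen] := xLambda_spec.
by rewrite (sum_paths L L_finite)// sumx mulr1.
Qed.

Let wXE s g : w g `^ s = c (flen g) `^ (- (s / delta)) * x (fsrc g) `^ s.
Proof.
rewrite wE powRM ?powR_ge0 ?(ltW (x_gt0 _))// -powRrM; congr (_ `^ _ * _).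
by rewrite mul1r mulNr mulrC.
Qed.

Let cX s n : c n `^ (- (s / delta)) * c n = c n `^ (1 - s / delta).
Proof.
rewrite addrC powRD ?(gt_eqF (c_gt0 _)) ?implybT//.
by rewrite powRr1 ?(ltW (c_gt0 _)).
Qed.

(** Termwise, x^s <= 1 <= x / m, which reduces the sum to the known level sum of x. *)
Let level_le (m s : R) n : 0 < m -> 0 < s -> (forall v, m <= x v) ->
  \sum_(g <- paths L n) w g `^ s <= m^-1 * c n `^ (1 - s / delta).
Proof.
move=> m0 s0 mx; rewrite -cX -[X in _ * (_ * X)]sum_level !mulr_sumr !big_seq.
apply: ler_sum => g; rewrite mem_paths// => /eqP gn; rewrite wXE gn mulrCA.
rewrite ler_wpM2l ?powR_ge0//; apply: (@le_trans _ _ 1).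
  rewrite -[leRHS](one_powR s).
  by rewrite ge0_ler_powR ?nnegrE ?ler01 ?xLambda_le1 ?(ltW s0) ?(ltW (x_gt0 _)).
by rewrite mulrC ler_pdivlMr// mul1r.
Qed.

(** Termwise, m^s x <= m^s <= x^s, since x <= 1. *)
Let level_ge (m s : R) n : 0 < m -> 0 < s -> (forall v, m <= x v) ->
  m `^ s * c n `^ (1 - s / delta) <= \sum_(g <- paths L n) w g `^ s.
Proof.
move=> m0 s0 mx; rewrite -cX -[X in _ * (_ * X)]sum_level !mulr_sumr !big_seq.
apply: ler_sum => g; rewrite mem_paths// => /eqP gn; rewrite wXE gn mulrCA.
rewrite ler_wpM2l ?powR_ge0//.
apply: (@le_trans _ _ (m `^ s)).
  by rewrite ler_piMr ?powR_ge0 ?xLambda_le1.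
by rewrite ge0_ler_powR ?nnegrE ?mx ?(ltW s0) ?(ltW m0) ?(ltW (x_gt0 _)).
Qed.

Lemma weight_series_lty s : delta < s ->
  (\esum_(g in [set: bpath L]) (w g `^ s)%:E < +oo)%E.
Proof.
move=> ds; have s0 := lt_trans delta_gt0 ds.
have [m m0 mx] := seq_pos_lb (verts L) _ x_gt0.
have {}mx v : m <= x v by rewrite mx// mem_verts.
set a := fun n => m^-1 * c n `^ (1 - s / delta).
set r := P `^ (1 - s / delta).
have r1 : r < 1.
  by rewrite gt1_powR_lt1 ?prod_rho_gt1// subr_lt0 ltr_pdivlMr ?mul1r.
have a0 n : 0 <= a n by rewrite mulr_ge0 ?invr_ge0 ?powR_ge0 ?ltW.
have ar n : a (k + n)%N <= r * a n.
  have PR := ltW P_gt0; have cR := ltW (c_gt0 n).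
  by rewrite /a /r cD powRM// [leLHS]mulrCA lexx.
apply: (@le_lt_trans _ _ ((\sum_(n < k) a n) / (1 - r))%:E); last exact: ltry.
apply: (esum_graded_ub (paths_uniq L) (mem_paths L L_finite)) => [g|N].
  exact: powR_ge0.
apply: le_trans (sum_quasi_geometric_le a k r N _ a0 ar); last first.
  by rewrite r1 powR_ge0.
by apply: ler_sum => n _; exact: level_le.
Qed.

(* The constant is uniform in [s], which serves both the divergence for
   [s <= delta] and the limit at [delta]. *)
Lemma weight_series_lb : exists2 K : R, 0 < K & forall (N : nat) (s : R),
  0 < s <= 2 * delta -> -1 <= N%:R * (1 - s / delta) ->
  ((N%:R * K)%:E <= \esum_(g in [set: bpath L]) (w g `^ s)%:E)%E.
Proof.
have [m' m'0 mx'] := seq_pos_lb (verts L) _ x_gt0.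
(* The cap at 1 makes m^s nonincreasing in [s], so that m^(2 delta) bounds it below on the whole
   range of [s]. *)
pose m := Num.min m' 1.
have m0 : 0 < m by rewrite lt_min m'0 ltr01.
have m1 : m <= 1 by rewrite ge_min lexx orbT.
have mx v : m <= x v by rewrite ge_min mx'// mem_verts.
exists (m `^ (2 * delta) * P^-1).
  by rewrite mulr_gt0 ?powR_gt0 ?invr_gt0.
move=> N s /andP[s0 s2] Ns.
apply: le_trans; last first.
  apply: (esum_graded_lb (paths_uniq L) (mem_paths L L_finite)
    _ (k * N)) => g.
  exact: powR_ge0.
rewrite lee_fin; apply: le_trans; last first.
  apply: (sum_multiples_le (fun n => \sum_(g <- paths L n) w g `^ s)) => // n.
  by apply: sumr_ge0 => g _; exact: powR_ge0.
(* Each of the N levels kq with q < N contributes at least K: there c(kq) = P^q, and P^(q (1 -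
   s/delta)) >= P^(-1) since the exponent is at least -1. *)
rewrite mulr_natl -[N in _ *+ N]card_ord -sumr_const.
apply: ler_sum => q _; apply: le_trans (level_ge _ _ _ m0 s0 mx).
rewrite cM; apply: ler_pM; rewrite ?powR_ge0 ?invr_ge0 ?(ltW P_gt0)//.
  by rewrite ger_powR ?m0.
rewrite -powR_inv1 ?(ltW P_gt0)// -powR_mulrn ?(ltW P_gt0)// -powRrM.
rewrite ler_powR ?(ltW prod_rho_gt1)//.
have [e0|e0] := leP 0 (1 - s / delta).
  by apply: (@le_trans _ _ 0); rewrite ?mulr_ge0// oppr_le0.
apply: le_trans Ns _; rewrite ler_wnM2r ?(ltW e0)//.
by rewrite ler_nat ltnW.
Qed.

End LevelSums.

Theorem theorem3p14 (R : realType) (k : nat) (L : kgraph k)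
    (L_nonempty : [set: kvert L] !=set0)
    (L_finite : kgraph_finite L)
    (L_connected : strongly_connected L)
    (delta : R) (delta_gt0 : 0 < delta) (delta_lt1 : delta < 1)
    (w_weight : is_weight (w_delta L delta))
    (w_diam : forall g : bpath L, w_delta L delta g = diam delta g) :
  [/\ forall s : R, 0 < s ->
        zeta L delta s
        = (\esum_(g in [set: bpath L]) (w_delta L delta g `^ s)%:E)%E,
      abscissa_of_convergence (zeta L delta) delta,
      zeta L delta s @[s --> delta^'+] --> +oo%E
    & forall tau : bpath L -> ipath L * ipath L,
        choice_function delta tau -> finitely_summable (PB_triple delta tau)].
Proof.
have diam_gt0 (g : bpath L) : 0 < diam delta g.
  by rewrite -w_diam; case: w_weight.
have zetaE s : zeta L delta s =
    (\esum_(g in [set: bpath L]) (w_delta L delta g `^ s)%:E)%E.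
  by rewrite zeta_series//; apply: eq_esum => g _; rewrite w_diam.
have zeta_lty s : delta < s -> (zeta L delta s < +oo)%E.
  by move=> ds; rewrite zetaE; exact: weight_series_lty.
have [K K0 KP] :=
  weight_series_lb L_nonempty L_finite delta_gt0 w_weight w_diam.
have delta2 : delta < 2 * delta by rewrite ltr_pMl// ltr1n.
(* The successor keeps [N] positive, as delta / N is formed below. *)
have KN (A : R) : exists2 N, (0 < N)%N & A <= N%:R * K.
  exists (Num.bound `|A / K|).+1 => //; rewrite -ler_pdivrMr//.
  apply: (le_trans (ler_norm _)); apply: ltW.
  by rewrite (lt_le_trans (archi_boundP (normr_ge0 _)))// ler_nat leqnSn.
have zeta_oo s : 0 < s -> s <= delta -> zeta L delta s = +oo%E.
  move=> s0 sd; apply: eq_infty => A; rewrite zetaE; have [N _ AN] := KN A.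
  apply: (@le_trans _ _ (N%:R * K)%:E); first by rewrite lee_fin.
  apply: KP; first by rewrite s0 (le_trans sd)// ltW.
  (* For s <= delta the factor 1 - s/delta is nonnegative, so the lower bound holds for every
     [N]. *)
  apply: (@le_trans _ _ 0); first by rewrite oppr_le0.
  by rewrite mulr_ge0// subr_ge0 ler_pdivrMr// mul1r.
split => [s _||| tau _]; first exact: zetaE.
- split=> [|s s0 sd]; last by apply: zeta_oo => //; exact: ltW.
  apply/eqP; rewrite eq_le; apply/andP; split.
    apply/lee_addgt0Pr => e e0; apply: ereal_inf_lbound.
    exists (delta + e) => //=; split; first by rewrite addr_gt0.
    by apply: zeta_lty; rewrite ltrDl.
  apply: le_ereal_inf_tmp => _ [s /= [s0 zs] <-]; rewrite lee_fin.
  by rewrite leNgt; apply/negP => /ltW sd; rewrite zeta_oo// in zs.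
- apply/cvgeyPge => A; have [N N0 AN] := KN A.
  have NR : 0 < N%:R :> R by rewrite ltr0n.
  near=> s; have ds : delta < s by near: s; exact: nbhs_right_gt.
  rewrite zetaE; apply: (@le_trans _ _ (N%:R * K)%:E); first by rewrite lee_fin.
  apply: KP.
    rewrite (lt_trans delta_gt0 ds) /=; near: s.
    by apply: nbhs_right_le; exact: delta2.
  (* This is the condition N (1 - s/delta) >= -1 solved for [s]. *)
  have sN : s <= delta + delta / N%:R.
    by near: s; apply: nbhs_right_le; rewrite ltrDl divr_gt0.
  rewrite -ler_pdivrMl// mulrN1 lerBrDr addrC lerBlDr ler_pdivrMr//.
  by rewrite mulrDl mul1r mulrC.
(* Any exponent above [delta] would do; D is the same for all [tau]. *)
- exists (2 * delta); first by rewrite mulr_gt0.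
  exact: zeta_lty.
Unshelve. all: by end_near.
Qed.
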